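(* Let $n\ge 0$ and $j\in\mathbb{Z}$ be integers. For every residue $k\in\{0,1,2,3,4\}$, the number of partitions $\pi$ of $5n+4$ with $\mathrm{BG\text{-}rank}(\pi)=j$ and $c_5(\pi)\equiv k \pmod 5$ equals $\frac{1}{5}p_j(5n+4)$. In particular $p_j(5n+4)\equiv 0\pmod 5$ for all $j\in\mathbb{Z}$.
   Context: For a partition $\pi=(\lambda_1\ge\lambda_2\ge\cdots)$ (with $\lambda_i=0$ beyond the number of parts), $\mathrm{BG\text{-}rank}(\pi)=\sum_{j\ge1}(-1)^{j+1}\frac{1-(-1)^{\lambda_j}}{2}$. $p_j(m)$ denotes the number of partitions of $m$ with BG-rank equal to $j$. The $5$-residue diagram of $\pi$ labels the cell in row $i$ and column $j$ of the Young diagram of $\pi$ by the least nonnegative integer congruent to $j-i$ modulo $5$; $r_i(\pi,5)$ is the number of cells labelled $i$. The $5$-core crank is $c_5(\pi)\equiv 2\big(r_0(\pi,5)-r_4(\pi,5)\big)+\big(r_1(\pi,5)-r_3(\pi,5)\big)+1 \pmod 5$. *)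

(* Defs.v *)
From HB Require Import structures.
From mathcomp Require Import all_boot all_order all_algebra.
Set Implicit Arguments.
Unset Strict Implicit.
Unset Printing Implicit Defensive.
Import Order.TTheory GRing.Theory Num.Theory.
Local Open Scope ring_scope.

Definition is_partition_of (m : nat) (s : seq nat) : bool :=
  [&& sorted geq s, 0%N \notin s & sumn s == m].

Record intpart (m : nat) := IntPart {
  parts :> seq nat;
  parts_proof : is_partition_of m parts
}.

HB.instance Definition _ (m : nat) := [isSub for @parts m].
HB.instance Definition _ (m : nat) := [Countable of intpart m by <:].

(* Finiteness: a partition of m has at most m parts, each at most m. *)
Section IntpartFinite.
Variable m : nat.

Let encode (p : intpart m) : {bseq m of 'I_m.+1} :=
  insub_bseq m (map inord (parts p)).
Let decode (t : {bseq m of 'I_m.+1}) : option (intpart m) :=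
  insub (map val t).

Fact part_size_sumn (s : seq nat) : 0%N \notin s -> (size s <= sumn s)%N.
Proof.
elim: s => //= x s IHs; rewrite inE negb_or eq_sym -lt0n => /andP[x_gt0 /IHs].
by rewrite -add1n; apply: leq_add.
Qed.

Fact part_leq_sumn (s : seq nat) (x : nat) : x \in s -> (x <= sumn s)%N.
Proof. by rewrite sumnE => xs; rewrite (big_rem x xs) leq_addr. Qed.

Fact intpart_encodeK : pcancel encode decode.
Proof.
move=> p; rewrite /decode /encode.
have /and3P[_ s0 /eqP sm] := parts_proof p.
have szp : (size (map (@inord m) (parts p)) <= m)%N.
  by rewrite size_map -[leqRHS]sm part_size_sumn.
rewrite /insub_bseq insubdK // -map_comp map_id_in ?valK // => x xp /=.
by rewrite inordK // ltnS -[leqRHS]sm part_leq_sumn.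
Qed.

HB.instance Definition _ : isFinite (intpart m) :=
  PCanIsFinite intpart_encodeK.
End IntpartFinite.

(* Rows and columns are numbered from 0, so row i holds the part lambda_(i+1)
   and carries the sign (-1)^(i+2) = (-1)^i.  The division by 2 is exact. *)
Definition BG_rank (s : seq nat) : int :=
  \sum_(i < size s) (-1) ^+ i * ((1 - (-1) ^+ nth 0%N s i) %/ 2)%Z.

Definition partitions_BG (j : int) (m : nat) : {set intpart m} :=
  [set p : intpart m | BG_rank p == j].

Definition num_BG (j : int) (m : nat) : nat := #|partitions_BG j m|.

(* For t > 0, %% is the least nonnegative residue.  Shifting both numberings
   from 1 to 0 leaves the difference (column - row) unchanged. *)
Definition cell_residue (t row col : nat) : int :=
  ((col%:Z - row%:Z) %% t%:Z)%Z.

Definition residue_count (i : nat) (s : seq nat) (t : nat) : nat :=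
  (\sum_(row < size s) \sum_(col < nth 0 s row)
     (cell_residue t row col == i%:Z%R))%N.

(* An integer representative; only its class modulo 5 is meaningful. *)
Definition core_crank5 (s : seq nat) : int :=
  let r i : int := (residue_count i s 5)%:Z in
  2 * (r 0%N - r 4%N) + (r 1%N - r 3%N) + 1.

(* Main.v *)
(* A partition with parts lambda_0 >= lambda_1 >= ... is encoded by its beads
   lambda_i - i - 1.  Summed against a weight G, relative to the beads of the
   empty partition, the beads give the size (G x = x), twice the BG-rank
   (G x = (-1)^x) and the 5-core crank (G depending on x mod 5).  On the
   5-abacus the charges c_0, ..., c_4 of the runners have sum 0, and for size
   5n+4 they satisfy sum a c_a = -1 (mod 5).  They can then be written in the
   coordinates of Garvan, Kim and Stanton:
     c_0 = al_0 + al_4, c_1 = - al_0 + al_1 + al_4, c_2 = - al_1 + al_2,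
     c_3 = - al_2 + al_3 - al_4, c_4 = - al_3 - al_4, with sum al_i = 1,
   in which the size of the 5-core is invariant under rotation of al and the
   crank is sum i al_i (mod 5).  Up to sign, the parities of the charges are
   those of the al_i + al_(i+1), so a rotation of al permutes them cyclically.
   Moving each runner along with this permutation, shifted so as to
   have the rotated charges, preserves the size and the BG-rank, is injective,
   and raises the crank by 1. *)
Require Import Defs.
From mathcomp Require Import all_boot all_order all_algebra.
From mathcomp Require Import zify ring.
Set Implicit Arguments.
Unset Strict Implicit.
Unset Printing Implicit Defensive.
Import Order.TTheory GRing.Theory Num.Theory.
Local Open Scope ring_scope.

(** * Bead sets and weighted sums over them *)

(* [S] is the set of beads; outside [[-A, A)] it agrees with the vacuum, whose
   beads are the negative integers. *)
Definition maya_in (A : nat) (S : int -> bool) : Prop :=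
  forall x : int, (A%:Z <= x -> ~~ S x) /\ (x < - A%:Z -> S x).

Lemma maya_in_pos (A : nat) (S : int -> bool) (x : int) :
  maya_in A S -> A%:Z <= x -> S x = false.
Proof. by move=> mS Ax; have [/(_ Ax)/negbTE] := mS x. Qed.

Lemma maya_in_neg (A : nat) (S : int -> bool) (x : int) :
  maya_in A S -> x < - A%:Z -> S x.
Proof. by move=> mS xA; have [_ /(_ xA)] := mS x. Qed.

(* The sum of [G] over the beads of [S] minus its sum over the vacuum, where the
   cancelling terms are left out. *)
Definition wsum (A : nat) (G : int -> int) (S : int -> bool) : int :=
  \sum_(0 <= i < A) (if S i%:Z then G i%:Z else 0)
  - \sum_(0 <= i < A) (if S (- i%:Z - 1) then 0 else G (- i%:Z - 1)).

Lemma maya_in_widen (A B : nat) (S : int -> bool) :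
  (A <= B)%N -> maya_in A S -> maya_in B S.
Proof. by move=> AB mS x; have [h1 h2] := mS x; split=> h; [apply: h1|apply: h2]; lia. Qed.

Lemma wsumS (A : nat) (G : int -> int) (S : int -> bool) :
  wsum A.+1 G S = wsum A G S + (if S A%:Z then G A%:Z else 0)
     - (if S (- A%:Z - 1) then 0 else G (- A%:Z - 1)).
Proof. by rewrite /wsum !big_nat_recr //=; ring. Qed.

Lemma wsum_widen (A B : nat) (G : int -> int) (S : int -> bool) :
  (A <= B)%N -> maya_in A S -> wsum B G S = wsum A G S.
Proof.
move=> AB mS; elim: B AB => [|B IH]; first by rewrite leqn0 => /eqP->.
rewrite leq_eqVlt => /predU1P[-> //|AB]; rewrite wsumS IH //.
by rewrite (maya_in_pos mS) ?(maya_in_neg mS); [ring|lia|lia].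
Qed.

Lemma eq_wsum (A : nat) (G H : int -> int) (S T : int -> bool) :
  G =1 H -> S =1 T -> wsum A G S = wsum A H T.
Proof. by move=> e f; rewrite /wsum; congr (_ - _); apply: eq_bigr => i _; rewrite e f. Qed.

Lemma wsumD (A : nat) (G H : int -> int) (S : int -> bool) :
  wsum A (fun x => G x + H x) S = wsum A G S + wsum A H S.
Proof.
rewrite /wsum addrACA -opprD -!big_split /=.
by congr (_ - _); apply: eq_bigr => i _; case: ifP.
Qed.

Lemma wsumZ (A : nat) (c : int) (G : int -> int) (S : int -> bool) :
  wsum A (fun x => c * G x) S = c * wsum A G S.
Proof.
rewrite /wsum mulrBr !mulr_sumr.
by congr (_ - _); apply: eq_bigr => i _; case: ifP; rewrite ?mulr0.
Qed.

(** * Translations of a bead set *)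

Definition shift (k : int) (S : int -> bool) (y : int) : bool := S (y - k).

Lemma maya_in_shift (A : nat) (k : int) (S : int -> bool) :
  maya_in A S -> maya_in (A + `|k|)%N (shift k S).
Proof. by move=> mS x; have [h1 h2] := mS (x - k); split=> h; [apply: h1|apply: h2]; lia. Qed.

(** The vacuum does not move along with [S]; [G 0] accounts for the position 0 that its translate
    would gain. *)
Lemma wsum_shift1 (A : nat) (G : int -> int) (S : int -> bool) :
  maya_in A S ->
  wsum A.+1 G (shift 1 S) = wsum A.+1 (fun y => G (y + 1)) S + G 0.
Proof.
move=> mS; rewrite [in RHS]/wsum big_nat_recr //= big_nat_recl //=.
rewrite /wsum big_nat_recl //= [X in _ - X = _]big_nat_recr //= /shift.
rewrite (@maya_in_pos A S A%:Z) ?(@maya_in_neg A S (- A%:Z - 1 - 1)) //; [|lia].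
have -> : \sum_(0 <= i < A) (if S (i.+1%:Z - 1) then G i.+1%:Z else 0)
  = \sum_(0 <= i < A) (if S i%:Z then G (i%:Z + 1) else 0).
  apply: eq_bigr => i _; rewrite (_ : i.+1%:Z - 1 = i%:Z); last by lia.
  by rewrite (_ : i%:Z + 1 = i.+1%:Z) //; lia.
have -> : \sum_(0 <= i < A) (if S (- i%:Z - 1 - 1) then 0 else G (- i%:Z - 1))
  = \sum_(0 <= i < A) (if S (- i.+1%:Z - 1) then 0 else G (- i.+1%:Z - 1 + 1)).
  apply: eq_bigr => i _; rewrite (_ : - i%:Z - 1 - 1 = - i.+1%:Z - 1); last by lia.
  by rewrite (_ : - i.+1%:Z - 1 + 1 = - i%:Z - 1) //; lia.
rewrite (_ : 0%:Z - 1 = - 0%:Z - 1) // (_ : - 0%:Z - 1 + 1 = 0) //.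
(* Only position -1 changes sides: a bead there contributes [G 0] on the left, a hole there cancels
   the extra [G 0] on the right. *)
by case: ifP => _; ring.
Qed.

(** This is (-1)^x for all integers, negative ones included, in a form open to [lia]. *)
Definition chi (x : int) : int := 1 - 2 * (x %% 2)%Z.

Lemma chiD1 (x : int) : chi (x + 1) = - chi x.
Proof. by rewrite /chi; lia. Qed.

Lemma chiB1 (x : int) : chi (x - 1) = - chi x.
Proof. by rewrite /chi; lia. Qed.

(** Charge, energy and alternating sum. The bound may stay existential since, by [wsum_widen], the
    values do not depend on it. *)
Definition maya_stat (S : int -> bool) (c e b : int) : Prop :=
  exists A : nat, [/\ maya_in A S, wsum A (fun=> 1) S = c,
    wsum A id S = e & wsum A chi S = b].

Lemma maya_stat_in (S : int -> bool) (c e b : int) : maya_stat S c e b ->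
  exists A : nat, forall B : nat, (A <= B)%N -> [/\ maya_in B S,
    wsum B (fun=> 1) S = c, wsum B id S = e & wsum B chi S = b].
Proof.
case=> A [mS <- <- <-]; exists A => B AB.
by rewrite !(wsum_widen _ AB mS); split=> //; apply: maya_in_widen mS.
Qed.

Lemma maya_stat_inj (S : int -> bool) (c e b c' e' b' : int) :
  maya_stat S c e b -> maya_stat S c' e' b' -> [/\ c = c', e = e' & b = b'].
Proof.
move=> /maya_stat_in[A hA] /maya_stat_in[B hB].
have [_ <- <- <-] := hA _ (leq_maxl A B).
by have [_ <- <- <-] := hB _ (leq_maxr A B).
Qed.

Lemma eq_maya_stat (S T : int -> bool) (c e b : int) :
  S =1 T -> maya_stat S c e b -> maya_stat T c e b.
Proof.
move=> ST [A [mS <- <- <-]]; exists A.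
split; try by apply: eq_wsum => // x; rewrite ST.
by move=> x; rewrite -ST.
Qed.

Lemma maya_stat_shift1 (S : int -> bool) (c e b : int) :
  maya_stat S c e b -> maya_stat (shift 1 S) (c + 1) (e + c) (1 - b).
Proof.
case=> A [mS ec ee eb]; exists A.+1.
have W G : wsum A.+1 G S = wsum A G S by apply: wsum_widen.
split; first by rewrite -addn1; exact: (@maya_in_shift A 1).
- by rewrite wsum_shift1 // W ec.
- by rewrite wsum_shift1 // (wsumD _ id (fun=> 1)) !W ec ee addr0.
- rewrite wsum_shift1 // (@eq_wsum _ _ (fun x => -1 * chi x) _ S) //.
    by rewrite wsumZ W eb /chi; lia.
  by move=> x; rewrite /chi; lia.
Qed.

(** Inverts [maya_stat_shift1]: the translate has some statistics, and shifting it back must return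
    those of [S]. *)
Lemma maya_stat_shiftN1 (S : int -> bool) (c e b : int) :
  maya_stat S c e b -> maya_stat (shift (- 1) S) (c - 1) (e - c + 1) (1 - b).
Proof.
case=> A [mS ec ee eb].
have mS' : maya_in A.+1 (shift (-1) S) by rewrite -addn1; apply: (@maya_in_shift A (-1)).
have st : maya_stat (shift (-1) S) (wsum A.+1 (fun=> 1) (shift (-1) S))
   (wsum A.+1 id (shift (-1) S)) (wsum A.+1 chi (shift (-1) S)) by exists A.+1.
have st0 : maya_stat S c e b by exists A.
have eqS : shift 1 (shift (- 1) S) =1 S by move=> x; rewrite /shift; congr S; ring.
have [h1 h2 h3] := maya_stat_inj (eq_maya_stat eqS (maya_stat_shift1 st)) st0.
 case: st => B [mB g1 g2 g3]; exists B.
by rewrite g1 g2 g3; split=> //; lia.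
Qed.

(** Both relations are doubled to avoid the fractions k(k-1)/2 and (1 - chi k)/2. *)
Lemma maya_stat_shift (k : int) (S : int -> bool) (c e b : int) :
  maya_stat S c e b ->
  exists e' b', [/\ maya_stat (shift k S) (c + k) e' b',
    2 * e' = 2 * e + 2 * k * c + k * (k - 1) &
    2 * b' = 2 * chi k * b + 1 - chi k].
Proof.
move=> st; elim/int_ind: k => [|k [e' [b' [st' he hb]]]|k [e' [b' [st' he hb]]]].
- exists e, b; rewrite addr0 /chi mod0z; split; [|ring|ring].
  by apply: eq_maya_stat st => x; rewrite /shift subr0.
- exists (e' + (c + k%:Z)), (1 - b').
  split; [|by rewrite mulrDr he; lia|rewrite mulrBr hb intS [1 + _]addrC chiD1; ring].
  have := maya_stat_shift1 st'; rewrite -addrA (_ : k%:Z + 1 = k.+1%:Z); last by lia.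
  by apply: eq_maya_stat => x; rewrite /shift; congr S; lia.
- exists (e' - (c - k%:Z) + 1), (1 - b').
  split; [|by move: he; lia|rewrite mulrBr hb (_ : - k.+1%:Z = - k%:Z - 1) ?chiB1; [ring|lia]].
  have := maya_stat_shiftN1 st'; rewrite -addrA (_ : - k%:Z - 1 = - k.+1%:Z); last by lia.
  by apply: eq_maya_stat => x; rewrite /shift; congr S; lia.
Qed.

(** * Beads of a partition *)

Definition bead (s : seq nat) (i : nat) : int := (nth 0%N s i)%:Z - i%:Z - 1.

(** Past the end of [s] the parts are 0, and their beads fill exactly the integers below [- size s];
    this makes membership decidable. *)
Definition beads (s : seq nat) (x : int) : bool :=
  (x < - (size s)%:Z) || (x \in [seq bead s i | i <- iota 0 (size s)]).

Lemma beadsP (s : seq nat) (x : int) :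
  reflect (exists i, x = bead s i) (beads s x).
Proof.
apply: (iffP orP) => [[xs|/mapP[i _ ->]]|[i ->]]; last 2 first.
- by exists i.
- case: (ltnP i (size s)) => [si|si]; last by left; rewrite /bead nth_default //; lia.
  by right; apply: map_f; rewrite mem_iota.
(* Here [x] is negative and is the bead [- i - 1] of a zero part. *)
exists (absz (x + 1)); rewrite /bead nth_default; lia.
Qed.

Lemma nth_sorted_geq (s : seq nat) (i j : nat) :
  sorted geq s -> (i <= j)%N -> (nth 0 s j <= nth 0 s i)%N.
Proof.
move=> ss ij; case: (ltnP j (size s)) => sj; last by rewrite (nth_default _ sj).
have geq_trans : transitive geq by move=> a b c /= ab bc; apply: leq_trans bc ab.
have si := leq_ltn_trans ij sj.
exact: (sorted_leq_nth geq_trans leqnn 0%N ss).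
Qed.

Lemma bead_ltr (s : seq nat) (i j : nat) :
  sorted geq s -> (i < j)%N -> bead s j < bead s i.
Proof. by move=> ss ij; have := nth_sorted_geq ss (ltnW ij); rewrite /bead; lia. Qed.

Lemma bead_inj (s : seq nat) : sorted geq s -> injective (bead s).
Proof.
move=> ss i j eij; case: (ltngtP i j) => // /(bead_ltr ss); rewrite eij; lia.
Qed.

Lemma mem_bead_iota (s : seq nat) (A : nat) (x : int) :
  sorted geq s -> (size s <= A)%N ->
  (x \in [seq bead s i | i <- iota 0 A]) = beads s x && (- A%:Z <= x).
Proof.
move=> ss sA; apply/mapP/andP => [[i]|[/beadsP[i ->] Ai]].
  rewrite mem_iota => iA ->; split; first by apply/beadsP; exists i.
  by rewrite /bead; lia.
exists i => //; rewrite mem_iota add0n /=.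
case: (ltnP i A) => // iA; move: Ai; rewrite /bead nth_default; lia.
Qed.

Lemma bead_iota_sorted (s : seq nat) (A : nat) :
  sorted geq s -> sorted >%R [seq bead s i | i <- iota 0 A].
Proof.
move=> ss; apply: (homo_sorted (e := ltn)); last exact: iota_ltn_sorted.
by move=> i j ij /=; apply: bead_ltr.
Qed.

Lemma part_notin0_nth (s : seq nat) (i : nat) :
  0%N \notin s -> (nth 0%N s i == 0%N) = (size s <= i)%N.
Proof.
move=> s0; case: leqP => si; first by rewrite nth_default.
by apply/eqP => e; move/negP: s0; apply; rewrite -e mem_nth.
Qed.

(** The beads form a strictly decreasing sequence, so their set determines each of them and hence
    each part; as parts are nonzero, the number of parts follows. *)
Lemma beads_inj (s t : seq nat) :
  sorted geq s -> 0%N \notin s -> sorted geq t -> 0%N \notin t ->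
  beads s =1 beads t -> s = t.
Proof.
move=> ss s0 st t0 est.
have en i : nth 0%N s i = nth 0%N t i.
  (* Large enough for [mem_bead_iota] on both sides and for bead [i] to be listed. *)
  pose A := (maxn (size s) (size t) + i.+1)%N.
  have : [seq bead s i | i <- iota 0 A] = [seq bead t i | i <- iota 0 A].
    apply: (irr_sorted_eq (leT := >%R)); rewrite ?bead_iota_sorted //.
    - by move=> a b c ab bc; apply: lt_trans bc ab.
    - by move=> a; rewrite /= ltxx.
    by move=> x; rewrite !mem_bead_iota ?est //; rewrite /A; lia.
  move/(congr1 (fun u => nth 0 u i)); rewrite !(nth_map 0%N) ?size_iota ?nth_iota;
    try by rewrite /A; lia.
  by rewrite add0n /bead; lia.
have es : size s = size t.
  apply/eqP; rewrite eqn_leq -!part_notin0_nth // -en en.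
  by rewrite !part_notin0_nth ?leqnn // -en part_notin0_nth ?leqnn.
by apply: (eq_from_nth (x0 := 0%N)).
Qed.

(** * Size, BG-rank and crank as weighted sums over beads *)

Definition window (A : nat) : seq int :=
  [seq i%:Z | i <- iota 0 A] ++ [seq - i%:Z - 1 | i <- iota 0 A].

Lemma mem_window (A : nat) (x : int) :
  (x \in window A) = (- A%:Z <= x) && (x < A%:Z).
Proof.
rewrite mem_cat; apply/orP/idP => [[] /mapP[i]|xA].
- by rewrite mem_iota => iA ->; lia.
- by rewrite mem_iota => iA ->; lia.
- case: (lerP 0 x) => x0; [left|right]; apply/mapP.
    by exists (absz x); rewrite ?mem_iota; lia.
  by exists (absz (x + 1)); rewrite ?mem_iota; lia.
Qed.

Lemma window_uniq (A : nat) : uniq (window A).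
Proof.
rewrite cat_uniq !map_inj_uniq ?iota_uniq ?andbT //=; try by move=> i j; lia.
by apply/hasPn => x /mapP[i _ ->]; apply/mapP => -[j _]; lia.
Qed.

Lemma wsum_window (A : nat) (G : int -> int) (S : int -> bool) :
  wsum A G S = \sum_(x <- [seq x <- window A | S x]) G x
               - \sum_(0 <= i < A) G (- i%:Z - 1).
Proof.
rewrite big_filter big_mkcond big_cat !big_map /wsum /index_iota subn0 /=.
rewrite -[RHS]addrA; congr (_ + _); rewrite -sumrN -sumrB; apply: eq_bigr => i _.
by case: ifP => _; ring.
Qed.

(** The beads in the window are the first [A] beads of [s]. Each is paired with the vacuum bead of
    the same index, and the pairs past the end of [s] cancel. *)
Lemma wsum_beads (s : seq nat) (A : nat) (G : int -> int) :
  sorted geq s -> (size s <= A)%N -> maya_in A (beads s) ->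
  wsum A G (beads s) = \sum_(0 <= i < size s) (G (bead s i) - G (- i%:Z - 1)).
Proof.
move=> ss sA mS; rewrite wsum_window.
have pe : perm_eq [seq x <- window A | beads s x] [seq bead s i | i <- iota 0 A].
  apply: uniq_perm; rewrite ?filter_uniq ?window_uniq //.
    by rewrite map_inj_in_uniq ?iota_uniq // => i j _ _; apply: bead_inj.
  move=> x; rewrite mem_filter mem_bead_iota // mem_window.
  case: (boolP (beads s x)) => //= bx; case: (ltrP x A%:Z) => //; rewrite ?andbT //.
  by move/(maya_in_pos mS); rewrite bx.
rewrite (perm_big _ pe) big_map /index_iota subn0 -sumrB.
rewrite (_ : iota 0 A = index_iota 0 A); last by rewrite /index_iota subn0.
rewrite (big_cat_nat (leq0n _) sA) /= [X in _ + X]big_nat_cond [X in _ + X]big1 ?addr0 //.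
by move=> i; rewrite andbT => /andP[si _]; rewrite /bead nth_default // sub0r subrr.
Qed.

Lemma sumn_nth (s : seq nat) : sumn s = (\sum_(0 <= i < size s) nth 0%N s i)%N.
Proof. by rewrite sumnE (big_nth 0%N). Qed.

Lemma maya_in_beads (m : nat) (s : seq nat) :
  is_partition_of m s -> maya_in m (beads s).
Proof.
case/and3P=> ss s0 /eqP sm x; split=> xm.
  apply/beadsP => -[i xi]; move: xm; rewrite xi /bead.
  case: (ltnP i (size s)) => si; last by rewrite nth_default //; lia.
  by have : (nth 0%N s i <= m)%N; [rewrite -sm part_leq_sumn ?mem_nth|lia].
by rewrite /beads; have := part_size_sumn s0; lia.
Qed.

(* A function whose increment from [x - 1] to [x] is the weight of a cell of
   content [x] in the crank (lemma [crank_weight_step]). *)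
Definition crank_weight (x : int) : int :=
  (2 * ((x %% 5)%Z == 0%Z) + 3 * ((x %% 5)%Z == 1%Z) + 3 * ((x %% 5)%Z == 2%Z)
   + 2 * ((x %% 5)%Z == 3%Z))%N%:Z.

Lemma crank_weight_step (x : int) :
  let r k : int := ((x %% 5)%Z == k%:Z) in
  crank_weight x - crank_weight (x - 1)
  = 2 * (r 0%N - r 4%N) + (r 1%N - r 3%N).
Proof.
rewrite /= /crank_weight -[((x - 1) %% 5)%Z]modzDml.
have : (0 <= (x %% 5)%Z) && ((x %% 5)%Z < 5) by lia.
by case: (x %% 5)%Z => // -[|[|[|[|[|]]]]].
Qed.

(** Telescoping along row [i]: each new cell moves the bead up by one, to the content of that
    cell. *)
Lemma crank_weight_row (i l : nat) :
  let r k c : int := (cell_residue 5 i c == k%:Z) in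
  crank_weight (l%:Z - i%:Z - 1) - crank_weight (- i%:Z - 1) =
  \sum_(c < l) (2 * (r 0%N c - r 4%N c) + (r 1%N c - r 3%N c)).
Proof.
move=> r; elim: l => [|l IH]; first by rewrite big_ord0 sub0r subrr.
rewrite big_ord_recr /= -IH /r /cell_residue -crank_weight_step.
by rewrite (_ : l.+1%:Z - i%:Z - 1 = l%:Z - i%:Z); [ring|lia].
Qed.

Lemma core_crank5E (s : seq nat) :
  core_crank5 s - 1 = \sum_(0 <= i < size s)
    (crank_weight (bead s i) - crank_weight (- i%:Z - 1)).
Proof.
rewrite /core_crank5 addrK big_mkord.
under eq_bigr => i _ do rewrite crank_weight_row.
have rE k : (residue_count k s 5)%:Z = \sum_(i < size s) \sum_(c < nth 0%N s i)
    (cell_residue 5 i c == k%:Z)%:Z.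
  rewrite /residue_count (big_morph Posz PoszD (erefl _)); apply: eq_bigr => i _.
  by rewrite (big_morph Posz PoszD (erefl _)).
rewrite !rE -!sumrB mulr_sumr -big_split /=; apply: eq_bigr => i _.
by rewrite -!sumrB mulr_sumr -big_split.
Qed.

Lemma wsum_partition (m A : nat) (G : int -> int) (s : seq nat) :
  is_partition_of m s -> (m <= A)%N ->
  wsum A G (beads s) = \sum_(0 <= i < size s) (G (bead s i) - G (- i%:Z - 1)).
Proof.
move=> ps mA; have /and3P[ss s0 /eqP sm] := ps.
apply: wsum_beads => //; last exact: maya_in_widen mA (maya_in_beads ps).
by have := part_size_sumn s0; lia.
Qed.

Lemma wsum_beads_charge (m A : nat) (s : seq nat) :
  is_partition_of m s -> (m <= A)%N -> wsum A (fun=> 1) (beads s) = 0.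
Proof. by move=> ps mA; rewrite (wsum_partition _ ps mA) big1 // => i _; rewrite subrr. Qed.

Lemma wsum_beads_size (m A : nat) (s : seq nat) :
  is_partition_of m s -> (m <= A)%N -> wsum A id (beads s) = m%:Z.
Proof.
move=> ps mA; rewrite (wsum_partition _ ps mA).
have /and3P[_ _ /eqP <-] := ps; rewrite sumn_nth.
rewrite (big_morph Posz PoszD (erefl _)); apply: eq_bigr => i _.
by rewrite /bead /=; ring.
Qed.

(** An even part leaves the parity of its bead unchanged; an odd part in row [i] changes [chi] from
    -(-1)^i to (-1)^i, whence the factor 2. *)
Lemma wsum_beads_BG (m A : nat) (s : seq nat) :
  is_partition_of m s -> (m <= A)%N -> wsum A chi (beads s) = 2 * BG_rank s.
Proof.
move=> ps mA; rewrite (wsum_partition _ ps mA) /BG_rank mulr_sumr big_mkord; apply: eq_bigr => i _.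
rewrite /bead.
have -> : ((1 - (-1) ^+ nth 0%N s i) %/ 2)%Z = ((nth 0%N s i)%:Z %% 2)%Z :> int.
  by rewrite -signr_odd; have := modn2 (nth 0%N s i); case: odd => /=; lia.
rewrite -signr_odd; have := modn2 i; rewrite /chi; case: odd => /=; lia.
Qed.

Lemma wsum_beads_crank (m A : nat) (s : seq nat) :
  is_partition_of m s -> (m <= A)%N -> wsum A crank_weight (beads s) = core_crank5 s - 1.
Proof. by move=> ps mA; rewrite (wsum_partition _ ps mA) core_crank5E. Qed.

(** * Reconstruction of a partition from its beads *)

(** In a decreasing list the zeros come last, and the default 0 stands in for them once they are
    removed. *)
Lemma nth_filter_pos (t : seq nat) (i : nat) :
  sorted geq t -> nth 0%N [seq x <- t | (0 < x)%N] i = nth 0%N t i.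
Proof.
move=> st; elim: t st i => // x t IH st i /=.
case: (posnP x) => [x0|_]; last by case: i => //= i; apply: IH; apply: path_sorted st.
have tz j : nth 0%N (x :: t) j = 0%N.
  by apply/eqP; rewrite -leqn0 -[leqRHS]x0; apply: (nth_sorted_geq st (leq0n j)).
have -> : [seq x <- t | (0 < x)%N] = [::].
  apply/eqP; rewrite -[_ == _]negbK -has_filter; apply/hasPn => y /(nthP 0%N)[j _ <-].
  by rewrite -[nth _ _ _]/(nth 0%N (x :: t) j.+1) tz.
by rewrite tz nth_nil.
Qed.

Lemma size_beads_window (A : nat) (S : int -> bool) :
  wsum A (fun=> 1) S = 0 -> size [seq x <- window A | S x] = A.
Proof.
rewrite wsum_window big_const_seq iter_addr_0 sumr_const_nat subn0.
by rewrite count_predT => /eqP; rewrite subr_eq0 eqr_nat => /eqP.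
Qed.

(** Charge 0 puts exactly [A] beads in the window; listed decreasingly, the [i]-th one plus [i + 1]
    is the [i]-th part. *)
Lemma beads_surj (A : nat) (S : int -> bool) :
  maya_in A S -> wsum A (fun=> 1) S = 0 ->
  exists s, [/\ sorted geq s, 0%N \notin s & beads s =1 S].
Proof.
move=> mS /size_beads_window sz.
pose L := rev (sort <=%R [seq x <- window A | S x]).
have sL : size L = A by rewrite size_rev size_sort.
have memL x : (x \in L) = S x && (- A%:Z <= x).
  rewrite mem_rev mem_sort mem_filter mem_window; case: (boolP (S x)) => //= Sx.
  case: (ltrP x A%:Z); rewrite ?andbT // => /(maya_in_pos mS); by rewrite Sx.
have stepL i : (i.+1 < A)%N -> nth 0 L i.+1 < nth 0 L i.
  rewrite -sL => iA.
  have : sorted >%R L.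
    by rewrite rev_sorted sort_lt_sorted filter_uniq ?window_uniq.
  by move/(sortedP 0) => /(_ i iA).
(* The beads are distinct and at least [- A], so bead [i] is at least [- i - 1]. The parts are thus
   nonnegative and [absz] below loses nothing. *)
have lowL k : (k < A)%N -> k%:Z - A%:Z <= nth 0 L (A - k.+1).
  elim: k => [|k IH] kA.
    have : nth 0 L (A - 1) \in L by rewrite mem_nth ?sL; lia.
    by rewrite memL; lia.
  have := IH (ltnW kA); have := stepL (A - k.+2)%N.
  by rewrite (_ : (A - k.+2).+1 = A - k.+1)%N; lia.
pose t := mkseq (fun i => absz (nth 0 L i + i%:Z + 1)) A.
have tE i : (i < A)%N -> bead t i = nth 0 L i.
  move=> iA; rewrite /bead nth_mkseq //; have := lowL (A - i.+1)%N.
  by rewrite (_ : A - (A - i.+1).+1 = i)%N; lia.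
have st : sorted geq t.
  apply/(sortedP 0%N) => i; rewrite size_mkseq => iA.
  have := stepL _ iA; rewrite -!tE //; last exact: ltnW.
  by rewrite /bead /=; lia.
pose s := [seq x <- t | (0 < x)%N].
have ss : sorted geq s.
  by apply: sorted_filter => // a b c /= ab bc; apply: leq_trans bc ab.
exists s; split=> //; first by rewrite mem_filter.
move=> x; have -> : beads s x = beads t x.
  by apply/beadsP/beadsP => -[i ->]; exists i; rewrite /bead nth_filter_pos.
rewrite /beads size_mkseq; case: (ltrP x (- A%:Z)) => xA /=.
  by rewrite (maya_in_neg mS).
rewrite -[S x]andbT -xA -memL; congr (x \in _).
apply: (eq_from_nth (x0 := 0)); rewrite size_map size_iota ?sL // => i iA.
by rewrite (nth_map 0%N) ?size_iota // nth_iota // add0n tE.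
Qed.

(** * Runners of the 5-abacus *)

Definition runner (a : nat) (S : int -> bool) (y : int) : bool := S (5 * y + a%:Z).

Lemma maya_in_runner (A a : nat) (S : int -> bool) :
  (a < 5)%N -> maya_in (5 * A) S -> maya_in A (runner a S).
Proof.
by move=> a5 mS y; have [h1 h2] := mS (5 * y + a%:Z); split=> h; [apply: h1|apply: h2]; lia.
Qed.

Lemma runner_eqP (S T : int -> bool) :
  (forall a, (a < 5)%N -> runner a S =1 runner a T) -> S =1 T.
Proof.
move=> h x; have := h (absz (x %% 5)%Z) _ (x %/ 5)%Z; rewrite /runner.
by rewrite (_ : 5 * _ + _ = x); [apply; lia|lia].
Qed.

Lemma maya_in_runners (A : nat) (S : int -> bool) :
  (forall a, (a < 5)%N -> maya_in A (runner a S)) -> maya_in (5 * A) S.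
Proof.
move=> mS x; have := mS (absz (x %% 5)%Z) _ (x %/ 5)%Z; rewrite /runner.
rewrite (_ : 5 * _ + _ = x); last lia.
by case; [lia|move=> h1 h2; split=> h; [apply: h1|apply: h2]; lia].
Qed.

Lemma wsum_runners (A : nat) (G : int -> int) (S : int -> bool) :
  wsum (5 * A) G S =
  \sum_(a < 5) wsum A (fun y => G (5 * y + a%:Z)) (runner a S).
Proof.
elim: A => [|A IH].
  by rewrite /wsum muln0 !big_nil big1 // => a _; rewrite !big_nil.
have -> : (5 * A.+1 = (5 * A).+1.+1.+1.+1.+1)%N by lia.
rewrite !wsumS IH; under [RHS]eq_bigr => a _ do rewrite wsumS.
rewrite !big_ord_recl !big_ord0 /runner /=.
have pE (k : nat) : 5 * A%:Z + k%:Z = (5 * A + k)%N%:Z by lia.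
(* On the negative side the runners are met in reverse order, from 4 down to 0. *)
have nE (k : nat) : (k < 5)%N -> 5 * (- A%:Z - 1) + k%:Z = - (5 * A + (4 - k))%N%:Z - 1 by lia.
rewrite !pE !nE // /bump /= !addnS !addn0.
ring.
Qed.

Definition runner_stats (S : int -> bool) (c e b : nat -> int) : Prop :=
  forall a, (a < 5)%N -> maya_stat (runner a S) (c a) (e a) (b a).

Lemma runner_stats_ex (A : nat) (S : int -> bool) :
  maya_in A S -> exists c e b, runner_stats S c e b.
Proof.
move=> mS; have m5 : maya_in (5 * A) S by apply: maya_in_widen mS; lia.
exists (fun a => wsum A (fun=> 1) (runner a S)), (fun a => wsum A id (runner a S)),
  (fun a => wsum A chi (runner a S)) => a a5.
by exists A; split=> //; apply: maya_in_runner.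
Qed.

(** At position [y] of runner [a] the weights split: [id] is 5y + a, [chi] is chi(a) chi(y), and
    [crank_weight] depends on [a] alone. *)
Lemma runner_stats_wsum (S : int -> bool) (c e b : nat -> int) :
  runner_stats S c e b ->
  exists A : nat, forall B : nat, (A <= B)%N ->
  [/\ maya_in (5 * B) S,
      wsum (5 * B) (fun=> 1) S = c 0%N + c 1%N + c 2%N + c 3%N + c 4%N,
      wsum (5 * B) id S = 5 * (e 0%N + e 1%N + e 2%N + e 3%N + e 4%N)
                          + (c 1%N + 2 * c 2%N + 3 * c 3%N + 4 * c 4%N),
      wsum (5 * B) chi S = b 0%N - b 1%N + b 2%N - b 3%N + b 4%N &
      wsum (5 * B) crank_weight S = 2 * c 0%N + 3 * c 1%N + 3 * c 2%N + 2 * c 3%N].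
Proof.
move=> st.
have [A0 h0] := maya_stat_in (st 0%N isT).
have [A1 h1] := maya_stat_in (st 1%N isT).
have [A2 h2] := maya_stat_in (st 2%N isT).
have [A3 h3] := maya_stat_in (st 3%N isT).
have [A4 h4] := maya_stat_in (st 4%N isT).
exists (A0 + A1 + A2 + A3 + A4)%N => B AB.
have [m0 c0 e0 b0] := h0 B ltac:(lia).
have [m1 c1 e1 b1] := h1 B ltac:(lia).
have [m2 c2 e2 b2] := h2 B ltac:(lia).
have [m3 c3 e3 b3] := h3 B ltac:(lia).
have [m4 c4 e4 b4] := h4 B ltac:(lia).
have five (F : 'I_5 -> int) (f : nat -> int) : (forall a : 'I_5, F a = f a) ->
    \sum_(a < 5) F a = f 0%N + f 1%N + f 2%N + f 3%N + f 4%N.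
  by move=> h; rewrite (eq_bigr _ (fun a _ => h a)) !big_ord_recr big_ord0 /= add0r.
rewrite !wsum_runners; split.
- by apply: maya_in_runners => -[|[|[|[|[|]]]]].
- by rewrite (five _ (fun a => wsum B (fun=> 1) (runner a S))) // c0 c1 c2 c3 c4.
- rewrite (five _ (fun a => 5 * wsum B id (runner a S) + a%:Z * wsum B (fun=> 1) (runner a S))).
    by rewrite c0 c1 c2 c3 c4 e0 e1 e2 e3 e4; ring.
  move=> a; rewrite -!wsumZ -wsumD; apply: eq_wsum => // y; ring.
- rewrite (five _ (fun a => chi a%:Z * wsum B chi (runner a S))).
    have chi_lit : [/\ chi 0%N = 1, chi 1%N = -1, chi 2%N = 1, chi 3%N = -1 & chi 4%N = 1] by [].
    by case: chi_lit => -> -> -> -> ->; rewrite b0 b1 b2 b3 b4; ring.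
  move=> a; rewrite -wsumZ; apply: eq_wsum => // y; rewrite /chi.
  have : (5 * y + a%:Z = y + a%:Z %[mod 2])%Z by lia.
  move=> ->; have [/eqP ha|/eqP ha] : ((a%:Z %% 2)%Z == 0) \/ ((a%:Z %% 2)%Z == 1) by lia.
    by rewrite ha; lia.
  by rewrite ha; lia.
- rewrite (five _ (fun a => crank_weight a%:Z * wsum B (fun=> 1) (runner a S))).
    have cw_lit : [/\ crank_weight 0%N = 2, crank_weight 1%N = 3, crank_weight 2%N = 3,
      crank_weight 3%N = 2 & crank_weight 4%N = 0] by [].
    by case: cw_lit => -> -> -> -> ->; rewrite c0 c1 c2 c3 c4; ring.
  move=> a; rewrite -wsumZ; apply: eq_wsum => // y.
  by rewrite mulr1 /crank_weight mulrC modzMDl.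
Qed.

Lemma partition_runner_stats (m : nat) (s : seq nat) (c e b : nat -> int) :
  is_partition_of m s -> runner_stats (beads s) c e b ->
  [/\ c 0%N + c 1%N + c 2%N + c 3%N + c 4%N = 0,
      5 * (e 0%N + e 1%N + e 2%N + e 3%N + e 4%N)
        + (c 1%N + 2 * c 2%N + 3 * c 3%N + 4 * c 4%N) = m%:Z,
      b 0%N - b 1%N + b 2%N - b 3%N + b 4%N = 2 * BG_rank s &
      2 * c 0%N + 3 * c 1%N + 3 * c 2%N + 2 * c 3%N = core_crank5 s - 1].
Proof.
move=> ps /runner_stats_wsum[A h].
have [mS <- <- <- <-] := h (A + m)%N (leq_addr _ _).
have mA : (m <= 5 * (A + m))%N by lia.
rewrite (wsum_beads_charge ps mA) (wsum_beads_size ps mA) (wsum_beads_BG ps mA).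
by rewrite (wsum_beads_crank ps mA).
Qed.

Lemma partition_of_runner_stats (m : nat) (S : int -> bool) (c e b : nat -> int) :
  runner_stats S c e b ->
  c 0%N + c 1%N + c 2%N + c 3%N + c 4%N = 0 ->
  5 * (e 0%N + e 1%N + e 2%N + e 3%N + e 4%N)
    + (c 1%N + 2 * c 2%N + 3 * c 3%N + 4 * c 4%N) = m%:Z ->
  exists2 s, is_partition_of m s & beads s =1 S.
Proof.
move=> /runner_stats_wsum[A h] hc he.
have [mS wc _ _ _] := h A (leqnn _); rewrite hc in wc.
have [s [ss s0 sS]] := beads_surj mS wc; exists s => //.
have ps : is_partition_of (sumn s) s by rewrite /is_partition_of ss s0 eqxx.
have [_ _ we _ _] := h (A + sumn s)%N (leq_addr _ _).
have mA : (sumn s <= 5 * (A + sumn s))%N by lia.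
(* The energy computed from the runners and the one computed from [s] must agree, which identifies
   [sumn s] with [m]. *)
have := wsum_beads_size ps mA; rewrite (eq_wsum _ (G := id) (H := id) _ sS) // we he => -[ms].
by rewrite ms.
Qed.

(** * Rotation of the charge coordinates *)

Definition crank_charges (al : nat -> int) : nat -> int :=
  nth 0 [:: al 0%N + al 4%N; - al 0%N + al 1%N + al 4%N; - al 1%N + al 2%N;
            - al 2%N + al 3%N - al 4%N; - al 3%N - al 4%N].

(* Runner [r] is replaced by runner [runner_source r], whose charge plus index
   has the same parity as that of the rotated charge at [r]. *)
Definition runner_source : nat -> nat := nth 0%N [:: 4; 2; 3; 0; 1]%N.

(** The rotated charge at [r] minus the charge of its source, simplified by sum al_i = 1 so that its
    parity is visible: even at 0, odd elsewhere. *)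
Definition runner_shift (al : nat -> int) : nat -> int :=
  nth 0 [:: 2 * al 3%N + 2 * al 4%N; 1 - 2 * al 2%N - 2 * al 4%N;
            1 - 2 * al 0%N - 2 * al 3%N; 2 * al 2%N - 1; 2 * al 0%N - 1].

Definition sum5 (f : nat -> int) : int := f 0%N + f 1%N + f 2%N + f 3%N + f 4%N.

Definition orbit_step (S T : int -> bool) : Prop :=
  exists al e b, [/\ sum5 al = 1, runner_stats S (crank_charges al) e b &
    forall r, (r < 5)%N ->
      runner r T =1 shift (runner_shift al r) (runner (runner_source r) S)].

Definition rot_charges (al : nat -> int) : nat -> int :=
  crank_charges (nth 0 [:: al 4%N; al 0%N; al 1%N; al 2%N; al 3%N]).

Lemma rot_chargesE (al : nat -> int) (r : nat) : sum5 al = 1 -> (r < 5)%N ->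
  rot_charges al r = crank_charges al (runner_source r) + runner_shift al r.
Proof.
by rewrite /sum5 => s1; case: r => [|[|[|[|[|//]]]]] _;
  rewrite /rot_charges /crank_charges /runner_shift /runner_source /=; lia.
Qed.

Lemma runner_source_lt (r : nat) : (runner_source r < 5)%N.
Proof. by case: r => [|[|[|[|[|r]]]]] //; rewrite /runner_source nth_default. Qed.

(** Shifts preserve 2e - c(c - 1) on each runner, so the size changes only through a polynomial in
    the charges, which is invariant under rotation when sum al_i = 1. *)
Lemma orbit_step_stats (S T : int -> bool) (al e b : nat -> int) :
  sum5 al = 1 -> runner_stats S (crank_charges al) e b ->
  (forall r, (r < 5)%N ->
      runner r T =1 shift (runner_shift al r) (runner (runner_source r) S)) ->
  exists e' b', [/\ runner_stats T (rot_charges al) e' b',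
    5 * sum5 e' + (rot_charges al 1%N + 2 * rot_charges al 2%N
                   + 3 * rot_charges al 3%N + 4 * rot_charges al 4%N)
    = 5 * sum5 e + (crank_charges al 1%N + 2 * crank_charges al 2%N
                   + 3 * crank_charges al 3%N + 4 * crank_charges al 4%N) &
    b' 0%N - b' 1%N + b' 2%N - b' 3%N + b' 4%N
    = b 0%N - b 1%N + b 2%N - b 3%N + b 4%N].
Proof.
move=> s1 st hT.
have sh r : (r < 5)%N -> exists e' b', [/\ maya_stat (runner r T) (rot_charges al r) e' b',
    2 * e' = 2 * e (runner_source r)
      + 2 * runner_shift al r * crank_charges al (runner_source r)
      + runner_shift al r * (runner_shift al r - 1) &
    2 * b' = 2 * chi (runner_shift al r) * b (runner_source r) + 1
      - chi (runner_shift al r)].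
  move=> r5; have [e' [b' [sT he hb]]] :=
    maya_stat_shift (runner_shift al r) (st _ (runner_source_lt r)).
  exists e', b'; rewrite rot_chargesE //; split=> //.
  by apply: eq_maya_stat sT => x; rewrite hT.
have [e0 [b0 [st0 he0 hb0]]] := sh 0%N isT.
have [e1 [b1 [st1 he1 hb1]]] := sh 1%N isT.
have [e2 [b2 [st2 he2 hb2]]] := sh 2%N isT.
have [e3 [b3 [st3 he3 hb3]]] := sh 3%N isT.
have [e4 [b4 [st4 he4 hb4]]] := sh 4%N isT.
exists (nth 0 [:: e0; e1; e2; e3; e4]), (nth 0 [:: b0; b1; b2; b3; b4]).
split; first by case=> [|[|[|[|[|]]]]].
(* The size identity holds only modulo sum al_i = 1, so one coordinate is eliminated before
   [ring]. *)
- have a4 : al 4%N = 1 - al 0%N - al 1%N - al 2%N - al 3%N.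
    by move: s1; rewrite /sum5; lia.
  apply: (@mulfI _ 2) => //; rewrite /sum5 !mulrDr /=.
  rewrite !(mulrCA 2 5) he0 he1 he2 he3 he4 /rot_charges /crank_charges /runner_shift /= a4.
  ring.
(* Runner 4 goes to 0, keeping its parity and its [b]. The other four change index parity and turn
   [b] into [1 - b]; their constants cancel in the alternating sum. *)
- have chi_odd x : chi (2 * x - 1) = -1 by rewrite /chi; lia.
  have chi_odd' x y : chi (1 - 2 * x - 2 * y) = -1 by rewrite /chi; lia.
  have chi_even x y : chi (2 * x + 2 * y) = 1 by rewrite /chi; lia.
  move: hb0 hb1 hb2 hb3 hb4; rewrite /= /runner_shift /= !chi_odd !chi_odd' !chi_even.
  by rewrite /runner_source /=; lia.
Qed.

(** [T] determines the rotated charges, hence [al] and the shifts; undoing these recovers every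
    runner, as [runner_source] permutes the indices. *)
Lemma orbit_step_inj (S1 S2 T : int -> bool) :
  orbit_step S1 T -> orbit_step S2 T -> S1 =1 S2.
Proof.
move=> [al [e [b [s1 st h1]]]] [be [e' [b' [s2 st' h2]]]].
have [f [d [stT _ _]]] := orbit_step_stats s1 st h1.
have [f' [d' [stT' _ _]]] := orbit_step_stats s2 st' h2.
have eqc r (r5 : (r < 5)%N) : rot_charges al r = rot_charges be r.
  by have [] := maya_stat_inj (stT r r5) (stT' r r5).
have eqal r : (r < 5)%N -> al r = be r.
  move: s1 s2 (eqc 0%N isT) (eqc 1%N isT) (eqc 2%N isT) (eqc 3%N isT) (eqc 4%N isT).
  rewrite /rot_charges /crank_charges /sum5 /=.
  by case: r => [|[|[|[|[|//]]]]] *; lia.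
have eqk r : runner_shift al r = runner_shift be r.
  by rewrite /runner_shift !eqal.
have src r : (r < 5)%N -> runner (runner_source r) S1 =1 runner (runner_source r) S2.
  move=> r5 x; have := h1 r r5 (x + runner_shift al r).
  by rewrite h2 // -eqk /shift addrK.
(* The arguments 3, 4, 1, 2, 0 form the inverse permutation of [runner_source]. *)
apply: runner_eqP => -[|[|[|[|[|//]]]]] _.
- exact: src 3%N isT.
- exact: src 4%N isT.
- exact: src 1%N isT.
- exact: src 2%N isT.
- exact: src 0%N isT.
Qed.

Lemma orbit_step_ex (S : int -> bool) (al e b : nat -> int) :
  sum5 al = 1 -> runner_stats S (crank_charges al) e b ->
  exists2 T, orbit_step S T & forall r, (r < 5)%N ->
      runner r T =1 shift (runner_shift al r) (runner (runner_source r) S).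
Proof.
move=> s1 st.
pose T x := shift (runner_shift al (absz (x %% 5)%Z))
  (runner (runner_source (absz (x %% 5)%Z)) S) (x %/ 5)%Z.
have hT r : (r < 5)%N ->
    runner r T =1 shift (runner_shift al r) (runner (runner_source r) S).
  move=> r5 y; have modE : absz ((5 * y + r%:Z) %% 5)%Z = r by lia.
  have divE : ((5 * y + r%:Z) %/ 5)%Z = y by lia.
  by rewrite -[LHS]/(T (5 * y + r%:Z)) /T modE divE.
by exists T => //; exists al, e, b.
Qed.

Lemma partition_orbit_step (n : nat) (s : seq nat) :
  is_partition_of (5 * n + 4) s ->
  exists t, [/\ is_partition_of (5 * n + 4) t, BG_rank t = BG_rank s,
    (core_crank5 t = core_crank5 s + 1 %[mod 5])%Z & orbit_step (beads s) (beads t)].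
Proof.
move=> ps; have [c [e [b st]]] := runner_stats_ex (maya_in_beads ps).
have [c0 hm hb hc] := partition_runner_stats ps st.
(* In the new coordinates sum a c_a = -1 - 5 al_4, while the size gives 5 (n + 1 - [sum5 e]) - 1.
   The residue 4 is what makes al_4 an integer; the other coordinates follow from the charges. *)
pose a4 := - (n%:Z + 1 - sum5 e).
pose a0 := c 0%N - a4.
pose a1 := c 1%N + a0 - a4.
pose al := nth 0 [:: a0; a1; c 2%N + a1; - c 4%N - a4; a4].
have s1 : sum5 al = 1 by rewrite /sum5 /al /= /a1 /a0 /a4 /sum5; lia.
have cE r : (r < 5)%N -> c r = crank_charges al r.
  case: r => [|[|[|[|[|//]]]]] _; rewrite /crank_charges /al /= /a1 /a0 /a4 /sum5; lia.
have {}st : runner_stats (beads s) (crank_charges al) e b.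
  by move=> r r5; rewrite -cE //; apply: st.
have [T sT hT] := orbit_step_ex s1 st.
have [e' [b' [st' he' hb']]] := orbit_step_stats s1 st hT.
have c0' : sum5 (rot_charges al) = 0.
  by rewrite /sum5 /rot_charges /crank_charges /=; ring.
have [|t pt tT] := partition_of_runner_stats (m := 5 * n + 4) st' c0'.
  by rewrite -hm -[X in 5 * X + _]/(sum5 e') he' !cE.
have stt : runner_stats (beads t) (rot_charges al) e' b'.
  by move=> r r5; apply: eq_maya_stat (st' r r5) => y; rewrite /runner tT.
have [_ _ hbt hct] := partition_runner_stats pt stt.
exists t; split=> //.
- by move: hbt; rewrite hb' hb; lia.
(* The two cranks differ by exactly 1 - 5 al_4. *)
- move: hct hc s1; rewrite !cE // /rot_charges /crank_charges /sum5 /=; lia.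
- have [al' [f [d [? ? hT']]]] := sT; exists al', f, d; split=> // r r5 y.
  by rewrite -hT' // /runner tT.
Qed.

(** * Equal counts of the crank classes *)

(** Injections from each class into the next around a cycle suffice for equal cardinalities, so
    surjectivity need not be shown. *)
Lemma leq_cycle5 (f : nat -> nat) :
  (forall k, (k < 5)%N -> (f k <= f (k.+1 %% 5))%N) ->
  forall k, (k < 5)%N -> f k = f 0%N.
Proof.
move=> h; have h0 : (f 0 <= f 1)%N := h 0%N isT.
have h1 : (f 1 <= f 2)%N := h 1%N isT; have h2 : (f 2 <= f 3)%N := h 2%N isT.
have h3 : (f 3 <= f 4)%N := h 3%N isT; have h4 : (f 4 <= f 0)%N := h 4%N isT.
by case=> [|[|[|[|[|//]]]]] _; lia.
Qed.

Theorem theorem4p1 (n : nat) (j : int) :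
  (forall k : nat, (k < 5)%N ->
     #|[set p in partitions_BG j (5 * n + 4)
         | (core_crank5 p == k%:Z %[mod 5])%Z]|%:R
     = (num_BG j (5 * n + 4))%:R / 5 :> rat)
  /\ (num_BG j (5 * n + 4) = 0 %[mod 5])%N.
Proof.
set m := (5 * n + 4)%N; pose D := partitions_BG j m.
pose X k := [set p in D | (core_crank5 p == k%:Z %[mod 5])%Z].
have /fin_all_exists[f hf] (p : intpart m) : exists q : intpart m,
    [/\ BG_rank q = BG_rank p, (core_crank5 q = core_crank5 p + 1 %[mod 5])%Z &
        orbit_step (beads p) (beads q)].
  have [t [pt ? ? ?]] := partition_orbit_step (parts_proof p).
  by exists (IntPart pt).
have f_inj : injective f.
  move=> p q epq; have [_ _ sp] := hf p; have [_ _ sq] := hf q.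
  rewrite epq in sp; apply: val_inj.
  have /and3P[? ? _] := parts_proof p; have /and3P[? ? _] := parts_proof q.
  by apply: beads_inj => //; apply: orbit_step_inj sp sq.
have cardX k : (k < 5)%N -> #|X k| = #|X 0%N|.
  apply: (leq_cycle5 (f := fun k => #|X k|)) => {}k k5.
  (* [f] sends class [k] into class [k + 1] modulo 5 while keeping the BG-rank. *)
  rewrite -(card_imset _ f_inj); apply/subset_leq_card/subsetP => q.
  case/imsetP=> p; rewrite !inE => /andP[/eqP bp /eqP cp] ->.
  have [-> cf _] := hf p; rewrite bp eqxx /= cf; apply/eqP.
  by rewrite -modzDml cp; lia.
have cardD : #|D| = (5 * #|X 0%N|)%N.
  (* Split [D] into the five fibres of the crank residue. *)
  pose h (p : intpart m) : 'I_5 := inord (absz (core_crank5 p %% 5)%Z).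
  rewrite -sum1_card (partition_big h xpredT) //=.
  rewrite -[5%N in RHS]card_ord -sum_nat_const; apply: eq_bigr => k _.
  rewrite -(cardX k) // -sum1_card; apply: eq_bigl => p; rewrite !inE.
  congr (_ && _); rewrite -val_eqE /= inordK; last by lia.
  by have := ltn_ord k; lia.
rewrite /num_BG -/D cardD; split; last by rewrite modnMr.
by move=> k k5; rewrite -/(X k) cardX // natrM mulrAC divff ?mul1r.
Qed.
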